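(* For a prime power $q$ and an integer $d \ge q-1$, let $X_{1,d}$ be the number of distinct zeros in $\mathbb{F}_q$ of a uniformly random polynomial in $\mathbb{F}_q[x]_d$. Then, as $q \to \infty$ (through prime powers, with $d \ge q-1$), the probability distribution of $X_{1,d}$ converges to the Poisson distribution with parameter $1$. That is, for every sequence of prime powers $q_m \to \infty$ and every sequence of integers $d_m \ge q_m - 1$, if $X^{(m)}$ denotes the number of distinct zeros in $\mathbb{F}_{q_m}$ of a uniformly random polynomial in $\mathbb{F}_{q_m}[x]_{d_m}$, then $\lim_{m\to\infty} P(X^{(m)} = k) = e^{-1}/k!$ for every integer $k \ge 0$.
   Context: $\mathbb{F}_q$ is the finite field with $q$ elements. $\mathbb{F}_q[x]_d$ denotes the set of polynomials in one variable over $\mathbb{F}_q$ of degree at most $d$ (including the zero polynomial, which has all $q$ elements of $\mathbb{F}_q$ as zeros); it is a finite set with $q^{d+1}$ elements, and a random polynomial is chosen uniformly from it. Zeros are elements $a \in \mathbb{F}_q$ with $f(a) = 0$, counted without multiplicity. *)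

(* Defs.v *)
From HB Require Import structures.
From mathcomp Require Import all_boot all_order all_algebra.
From mathcomp Require Import qpoly.
From mathcomp Require Import all_classical all_reals all_analysis.

Set Implicit Arguments.
Unset Strict Implicit.
Unset Printing Implicit Defensive.

Import Order.TTheory GRing.Theory Num.Theory.
Import numFieldNormedType.Exports.

Local Open Scope ring_scope.

Definition num_zeros (F : finFieldType) (p : {poly F}) : nat :=
  #|[set a : F | p.[a] == 0]|.

Definition unif_prob (R : realType) (T : finType) (E : {set T}) : R :=
  #|E|%:R / #|T|%:R.

(* [{poly_n F}] consists of the polynomials of size at most [n], that is, of
   degree less than [n] (with 0): hence the shift by one. *)
Definition prob_num_zeros (R : realType) (F : finFieldType) (d k : nat) : R :=
  unif_prob R [set p : {poly_(d.+1) F} | num_zeros p == k].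

(* Main.v *)
Require Import Defs.
From HB Require Import structures.
From mathcomp Require Import all_boot all_order all_algebra.
From mathcomp Require Import qpoly finfield ring.
From mathcomp Require Import all_classical all_reals all_analysis.
Import Order.TTheory GRing.Theory Num.Theory.
Import numFieldNormedType.Exports.
Local Open Scope ring_scope.

(** A polynomial of degree less than [q] over the field [F] with [q] elements
    can take any prescribed values on [F], so for [d >= q - 1] the evaluation
    map from the polynomials of degree at most [d] to the functions [F -> F] is
    a surjective additive map. Its fibres, the cosets of its kernel, all have
    the same size ([card_preim_additive]), hence the values of a uniformly
    random polynomial form a uniformly random function: they are independent
    and uniform in [F]. Each of the [q] points is thus a zero with probability
    [1 / q], independently of the others, and the number of zeros has exactly
    the binomial distribution with parameters [q] and [1 / q], whatever [d] is
    ([prob_num_zerosE]). The theorem is then the classical Poisson limit of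
    this binomial distribution ([cvg_binomial_poisson]), taken along [q]. *)

(* This joins the finite type and the additive group structures on functions
   into a finite group, as a target for evaluation. *)
HB.saturate finfun_of.

(** All fibres of [f] are translates of one another. The section [s] need not be
    additive: it only provides the translation by [s v - s (f x)] that moves a
    point [x] to the fibre over a given [v]. *)
Lemma card_preim_additive (U V : finZmodType) (f : U -> V) (s : V -> U)
    (S : {set V}) :
  {morph f : x y / x - y} -> cancel s f ->
  (#|[set x | f x \in S]| * #|V| = #|S| * #|U|)%N.
Proof.
move=> fB sK.
have f0 : f 0 = 0 by rewrite -(subr0 0) fB subrr.
have fD : {morph f : x y / x + y}.
  by move=> x y; rewrite -{1}(opprK y) fB -(sub0r y) fB f0 sub0r opprK.
(* Exchange the value [f x] with [v], keeping the position of [x] relative to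
   the section: this maps [f @^-1: S] times [V] onto [U] times [S]. *)
pose swap (xv : U * V) := (xv.1 - s (f xv.1) + s xv.2, f xv.1).
have swapK : involutive swap.
  by move=> [x v]; rewrite /swap /= fD fB !sK subrr add0r addrK subrK.
rewrite -!finset.cardsT [RHS]mulnC -!finset.cardsX.
rewrite -(card_imset _ (inv_inj swapK)); apply: fintype.eq_card => -[x v].
rewrite -[(x, v)]swapK (mem_imset _ _ (inv_inj swapK)) swapK !inE /= andbT.
by rewrite fD fB !sK subrr add0r.
Qed.

(** Fermat's little theorem: a nonzero element to the power [q - 1] is [1]. *)
Lemma fermat_indicator (F : finFieldType) (a x : F) :
  1 - (x - a) ^+ #|F|.-1 = (x == a)%:R.
Proof.
have q1 := finNzRing_gt1 F.
rewrite -subr_eq0; have [->|xa] := eqVneq (x - a) 0.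
  by rewrite expr0n -subn1 subn_eq0 leqNgt q1 subr0.
apply/eqP; rewrite subr_eq0 eq_sym; apply/eqP/(mulfI xa).
by rewrite -exprS prednK ?(ltnW q1)// expf_card mulr1.
Qed.

(** The interpolating polynomial of [g] at all points of [F]: over a finite
    field Lagrange's basis polynomials take this closed form. *)
Definition interp_poly (F : finFieldType) (g : {ffun F -> F}) : {poly F} :=
  \sum_(a : F) g a *: (1 - ('X - a%:P) ^+ #|F|.-1).

Lemma size_interp_poly (F : finFieldType) (g : {ffun F -> F}) :
  (size (interp_poly F g) <= #|F|)%N.
Proof.
have q0 := ltnW (finNzRing_gt1 F).
apply: (leq_trans (size_sum _ _ _)); apply/bigop.bigmax_leqP => a _.
apply: (leq_trans (size_scale_leq _ _)); apply: (leq_trans (size_polyD _ _)).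
by rewrite geq_max size_poly1 size_polyN size_exp_XsubC prednK ?q0 ?leqnn.
Qed.

Lemma horner_interp_poly (F : finFieldType) (g : {ffun F -> F}) (x : F) :
  (interp_poly F g).[x] = g x.
Proof.
rewrite horner_sum (bigD1 x)//= big1 => [|a ax];
  rewrite !hornerE fermat_indicator.
  by rewrite eqxx mulr1.
by rewrite eq_sym (negbTE ax) mulr0.
Qed.

(** Choose the set of the [k] zeros, then a nonzero value at each other point. *)
Lemma card_ffun_num_zeros (V : finZmodType) (T : finType) (k : nat) :
  #|[set g : {ffun T -> V} | #|[set a | g a == 0]| == k]| =
  ('C(#|T|, k) * #|V|.-1 ^ (#|T| - k))%N.
Proof.
rewrite -sum1_card.
(* Sort the functions by their zero sets; those with zero set [A] form the
   product family [B] over the points of [T]. *)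
rewrite (partition_big (fun g : {ffun T -> V} => [set a | g a == 0])
  (fun A : {set T} => #|A| == k)) => [|g]; last by rewrite inE.
rewrite (eq_bigr (fun=> (#|V|.-1 ^ (#|T| - k))%N)) => [|A /eqP kA]; last first.
  pose B a := if a \in A then pred1 (0 : V) else predC1 (0 : V).
  rewrite (eq_bigl [in family B]) => [|g].
    rewrite sum1_card card_family foldrE big_image /= (bigID [in A]) /=.
    rewrite big1 ?mul1n => [|a Aa]; last by rewrite /B Aa card1.
    rewrite (eq_bigr (fun=> #|V|.-1)) => [|a /negbTE Aa].
      by rewrite prod_nat_const -kA -(cardC [in A]) addKn.
    by rewrite /B Aa; move: (cardC1 (0 : V)).
  rewrite inE; apply/andP/familyP => [[_ /eqP gA] a|gB].
    by rewrite /B -gA !inE; case: ifP => ga; rewrite inE ?ga.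
  have gA : [set a | g a == 0] = A.
    by apply/setP => a; rewrite inE; move: (gB a); rewrite /B;
      case: ifP => Aa; rewrite inE // => /negbTE.
  by rewrite gA kA !eqxx.
rewrite sum_nat_const -card_draws; congr (_ * _)%N.
by apply: fintype.eq_card => A; rewrite inE.
Qed.

(** The number of zeros depends on a polynomial only through its evaluation map,
    which has equal fibres. *)
Lemma card_poly_num_zeros (F : finFieldType) (n k : nat) : (#|F| <= n)%N ->
  (#|[set p : {poly_n F} | num_zeros p == k]| * #|F| ^ #|F| =
   'C(#|F|, k) * #|F|.-1 ^ (#|F| - k) * #|{poly_n F}|)%N.
Proof.
move=> Fn.
pose ev (p : {poly_n F}) : {ffun F -> F} := [ffun a => p.[a]].
have sizeP (g : {ffun F -> F}) : interp_poly F g \is a poly_of_size n.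
  exact: leq_trans (size_interp_poly F g) Fn.
rewrite -card_ffun_num_zeros -card_ffun.
rewrite -(card_preim_additive _ _ ev (fun g => NPoly (sizeP g))).
- congr (_ * _)%N; apply: fintype.eq_card => p; rewrite !inE; congr (_ == _).
  by apply: fintype.eq_card => a; rewrite !inE ffunE.
- by move=> p r; apply/ffunP => a; rewrite !ffunE /= hornerD hornerN.
- by move=> g; apply/ffunP => a; rewrite ffunE /= horner_interp_poly.
Qed.

(** This is the probability of [k] successes in [q] independent trials of
    success probability [1 / q], since for [k <= q] the factor
    [(q - 1) ^ (q - k) / q ^ q] is [(1 / q) ^ k * (1 - 1 / q) ^ (q - k)]. *)
Lemma prob_num_zerosE (R : realType) (F : finFieldType) (d k : nat) :
  (#|F| - 1 <= d)%N ->
  prob_num_zeros R F d k =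
  'C(#|F|, k)%:R * (#|F|.-1)%:R ^+ (#|F| - k) / #|F|%:R ^+ #|F|.
Proof.
move=> Fd; rewrite /prob_num_zeros /unif_prob.
have q0 := ltnW (finNzRing_gt1 F).
have Fd1 : (#|F| <= d.+1)%N by rewrite -add1n -leq_subLR.
have T0 : #|{poly_(d.+1) F}|%:R != 0 :> R.
  by rewrite pnatr_eq0 card_npoly -lt0n expn_gt0 q0.
have Fq : #|F|%:R ^+ #|F| != 0 :> R by rewrite expf_neq0 // pnatr_eq0 -lt0n q0.
apply/eqP; rewrite eqr_div // -!natrX -!natrM eqr_nat.
by rewrite card_poly_num_zeros.
Qed.

Local Open Scope classical_set_scope.

Lemma cvg_natV (R : realType) : (n%:R^-1 : R) @[n --> \oo] --> (0 : R).
Proof. by rewrite -cvg_shiftS; exact: cvg_harmonic. Qed.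

Lemma cvg_1subVn (R : realType) : (1 - n%:R^-1 : R) @[n --> \oo] --> (1 : R).
Proof.
rewrite -[X in _ --> X]subr0; apply: cvgB; first exact: cvg_cst.
exact: cvg_natV.
Qed.

(** Squeeze, with both bounds from [1 + x <= expR x]. At [x = - 1 / n] it bounds
    the power above by [expR (- 1)]. At [x = y^-1 - 1], for [y = 1 - 1 / n], it
    bounds [y] below by [expR (1 - y^-1)], and [n * (1 - y^-1) = - y^-1] tends
    to [- 1]. *)
Lemma cvg_1subVn_exp (R : realType) :
  ((1 - n%:R^-1 : R) ^+ n) @[n --> \oo] --> expR (- 1 : R).
Proof.
apply: (@squeeze_cvgr _ _ _ _ (fun n => expR (- (1 - n%:R^-1)^-1))
                              (fun=> expR (- 1))); last 2 first.
- apply: (@cvg_comp _ _ _ (fun n => - (1 - n%:R^-1)^-1) expR _ _ _ _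
    (@continuous_expR R (- 1))).
  have := cvgN (cvgV (oner_neq0 R) (cvg_1subVn R)).
  by rewrite invr1; exact.
- exact: cvg_cst.
near=> n.
have n1 : (1 < n)%N by near: n; exact: nbhs_infty_gt.
have n0 : n%:R != 0 :> R by rewrite pnatr_eq0 -lt0n ltnW.
have y0 : 0 < 1 - n%:R^-1 :> R by rewrite subr_gt0 invf_lt1 ?ltr1n// ltr0n ltnW.
apply/andP; split.
  have -> : - (1 - n%:R^-1)^-1 = n%:R * (1 - (1 - n%:R^-1)^-1) :> R.
    by field; rewrite n0 subr_eq0 pnatr_eq1 gtn_eqF.
  rewrite expRM_natl; apply: lerXn2r; rewrite ?nnegrE ?expR_ge0 ?(ltW y0)//.
  rewrite -[leRHS]invrK -lef_pV2 ?posrE ?expR_gt0 ?invr_gt0 ?invrK//.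
  rewrite -expRN opprB.
  by rewrite (le_trans _ (expR_ge1Dx _))// [leRHS]addrC subrK.
have -> : - 1 = n%:R * - n%:R^-1 :> R by rewrite mulrN mulfV.
rewrite expRM_natl lerXn2r ?nnegrE ?expR_ge0 ?(ltW y0)//.
exact: expR_ge1Dx.
Unshelve. all: by end_near. Qed.

(** For [n >= k] the quotient is the product of the [1 - i / n] for [i < k], a
    fixed number of factors each of which tends to [1]. *)
Lemma cvg_ffact_exp (R : realType) (k : nat) :
  ((n ^_ k)%:R / n%:R ^+ k : R) @[n --> \oo] --> (1 : R).
Proof.
elim: k => [|k IHk].
  by apply: cvg_near_cst; near=> n; rewrite ffactn0 expr0 divr1.
have L : (((n ^_ k)%:R / n%:R ^+ k) * (1 - k%:R * n%:R^-1) : R) @[n --> \oo]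
    --> (1 * (1 - k%:R * 0) : R).
  apply: cvgM => //; apply: cvgB; first exact: cvg_cst.
  by apply: cvgM; [exact: cvg_cst | exact: cvg_natV].
rewrite mulr0 subr0 mul1r in L.
apply: cvg_trans L; apply: near_eq_cvg; near=> n.
have kn : (k < n)%N by near: n; exact: nbhs_infty_gt.
have n0 : n%:R != 0 :> R by rewrite pnatr_eq0 -lt0n (leq_ltn_trans _ kn).
rewrite ffactnSr natrM natrB ?(ltnW kn)// exprSr invfM mulrACA; congr (_ * _).
by rewrite mulrBl mulfV.
Unshelve. all: by end_near. Qed.

(** For large [n] the binomial weight is [(1 - 1 / n) ^ n / k!] times
    [n ^_ k / n ^ k / (1 - 1 / n) ^ k], and the second factor tends to [1]. *)
Lemma cvg_binomial_poisson (R : realType) (k : nat) :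
  ('C(n, k)%:R * (n.-1)%:R ^+ (n - k) / n%:R ^+ n : R) @[n --> \oo]
    --> expR (- 1) / k`!%:R.
Proof.
have L : ((1 - n%:R^-1) ^+ n / k`!%:R *
    ((n ^_ k)%:R / n%:R ^+ k / (1 - n%:R^-1) ^+ k) : R) @[n --> \oo]
    --> (expR (- 1) / k`!%:R * (1 / 1 ^+ k) : R).
  apply: cvgM; first by apply: cvgM; [exact: cvg_1subVn_exp | exact: cvg_cst].
  apply: cvgM; first exact: cvg_ffact_exp.
  apply: cvgV; first by rewrite expr1n oner_eq0.
  exact: cvg_comp (cvg_1subVn R) (@exprn_continuous R k 1).
rewrite expr1n divr1 mulr1 in L.
apply: cvg_trans L; apply: near_eq_cvg; near=> n.
(* Besides [k <= n] this gives [1 < n], so that [1 - 1 / n] is nonzero. *)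
have kn : (k.+1 < n)%N by near: n; exact: nbhs_infty_gt.
have n1 : (1 < n)%N by rewrite (leq_ltn_trans _ kn).
have n0 : n%:R != 0 :> R by rewrite pnatr_eq0 -lt0n ltnW.
have m0 : (n.-1)%:R != 0 :> R by rewrite pnatr_eq0 -lt0n -ltnS prednK // ltnW.
have k0 : k`!%:R != 0 :> R by rewrite pnatr_eq0 -lt0n fact_gt0.
have -> : 1 - n%:R^-1 = (n.-1)%:R / n%:R :> R.
  by rewrite -subn1 natrB ?(ltnW n1)// mulrBl mulfV// mul1r.
have kn' : (k <= n)%N by rewrite ltnW // ltnW.
rewrite -bin_ffact natrM.
have nE : (n.-1)%:R ^+ n = (n.-1)%:R ^+ (n - k) * (n.-1)%:R ^+ k :> R.
  by rewrite -exprD subnK.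
rewrite !expr_div_n nE.
by field; rewrite ?expf_neq0 ?k0 ?n0 ?m0.
Unshelve. all: by end_near. Qed.

Theorem corollary1p3 (R : realType) (q d : nat -> nat) (F : nat -> finFieldType)
    (card_F : forall m : nat, #|F m| = q m)
    (q_infty : q m @[m --> \oo] --> \oo)
    (d_ge : forall m : nat, (q m - 1 <= d m)%N) :
  forall k : nat,
    prob_num_zeros R (F m) (d m) k @[m --> \oo] --> expR (-1) / k`!%:R.
Proof.
move=> k.
have -> : (fun m => prob_num_zeros R (F m) (d m) k) =
    (fun n => 'C(n, k)%:R * (n.-1)%:R ^+ (n - k) / n%:R ^+ n : R) \o q.
  by apply/funext => m /=; rewrite prob_num_zerosE card_F.
exact: cvg_comp q_infty (cvg_binomial_poisson R k).
Qed.
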